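(* Let $G$ be a connected four-dimensional Lie group with Lie algebra $(\mathfrak{g},[\cdot,\cdot])$, let $\mathfrak{q}\subset\mathfrak{g}$ be a three-dimensional subspace generating $\mathfrak{g}$, and let $e_2$ be a nonzero vector of the one-dimensional subspace $\mathfrak{q}\cap\mathfrak{N}(\mathfrak{q})$. Let $d$ be the left-invariant sub-Riemannian metric on $G$ defined by a scalar product $(\cdot,\cdot)_1$ on $\mathfrak{q}$ with an orthonormal basis $(\tilde e_1,\tilde e_2,\tilde e_3)$ which is an adapted basis of $\mathfrak{q}$ with $\tilde e_2\parallel e_2$. Then, for $s\in\{1,-1\}$, the abnormal extremal $$g(t)=\exp\left(\frac{ste_2}{F(se_2)}\right),\quad t\in\mathbb{R},\qquad F(u)=\sqrt{(u,u)_1},$$ of $(G,d)$ is nonstrongly abnormal if and only if $[e_2,\mathfrak{q}]\subset\langle\tilde e_1,\tilde e_3\rangle$.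
   Context: $\langle\cdot\rangle$ denotes linear span. A subspace $\mathfrak{q}\subset\mathfrak{g}$ generates $\mathfrak{g}$ if the smallest Lie subalgebra containing it is $\mathfrak{g}$. $\mathfrak{N}(\mathfrak{q})=\{x\in\mathfrak{g}:[x,\mathfrak{q}]\subset\mathfrak{q}\}$ is the normalizer of $\mathfrak{q}$ in $\mathfrak{g}$; for three-dimensional generating $\mathfrak{q}$ in a four-dimensional $\mathfrak{g}$, $\mathfrak{q}\cap\mathfrak{N}(\mathfrak{q})$ is one-dimensional. An adapted basis of $\mathfrak{q}$ is a basis $(e_1,e_2,e_3)$ of $\mathfrak{q}$ such that $(e_1,e_2,e_3,e_4:=[e_1,e_3])$ is a basis of $\mathfrak{g}$ and, with $[e_i,e_j]=\sum_k C_{ij}^k e_k$, one has $C_{12}^4=C_{23}^4=0$ (equivalently, $[e_1,e_2],[e_2,e_3]\in\mathfrak{q}$). Put $U=\{u\in\mathfrak{q}: F(u)\le 1\}$. $d(g,h)$ is the minimal time $T\ge0$ for which there is an absolutely continuous curve from $g$ to $h$ on $[0,T]$ with $\dot g(t)=dl_{g(t)}(u(t))$ for a measurable $u(t)\in U$, where $l_g(h)=gh$. Extremals. An extremal of $(G,d)$ is an absolutely continuous curve $g:\Omega\to G$ on a maximal interval $\Omega\subset\mathbb{R}$, with a measurable control $u(t)\in\mathfrak{q}$ such that $\dot g(t)=dl_{g(t)}(u(t))$ and $F(u(t))=1$ for almost all $t$, for which there is a nowhere zero absolutely continuous $\psi:\Omega\to\mathfrak{g}^*$ (covectors being identified by left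 translations) such that for almost all $t$: $(\psi(t)(v))'=\psi(t)([u(t),v])$ for all $v\in\mathfrak{g}$, and $\psi(t)(u(t))=\max_{u\in U}\psi(t)(u)=M$ with a constant $M\ge 0$ (Pontryagin Maximum Principle). The extremal is abnormal (with respect to $\psi$) if $M=0$ and normal (with respect to $\psi$) if $M>0$. It is nonstrongly abnormal if it is abnormal with respect to some $\psi$ and normal with respect to another $\psi$; an abnormal extremal that is not nonstrongly abnormal is strongly abnormal. *)

(* Defs.v *)
From HB Require Import structures.
From mathcomp Require Import all_boot all_order all_algebra.
From mathcomp Require Import all_classical all_reals all_analysis.

Set Implicit Arguments.
Unset Strict Implicit.
Unset Printing Implicit Defensive.

Import Order.TTheory GRing.Theory Num.Theory.
Import numFieldNormedType.Exports.

Local Open Scope classical_set_scope.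
Local Open Scope ring_scope.

(* [O] is meant to be open; only the behaviour of [f] on [O] matters. *)
Fixpoint Ck_on (R : realType) (n k : nat) (O : set 'rV[R]_n)
    (f : 'rV[R]_n -> R) : Prop :=
  match k with
  | 0%N => forall x, O x -> {for x, continuous f}
  | k'.+1 => (forall x, O x -> differentiable f x) /\
             (forall v : 'rV[R]_n, Ck_on k' O (fun x => 'D_v f x))
  end.

Definition smooth_on (R : realType) (n : nat) (O : set 'rV[R]_n)
    (f : 'rV[R]_n -> R) : Prop := forall k, Ck_on k O f.

Definition smooth_map_on (R : realType) (n m : nat) (O : set 'rV[R]_n)
    (f : 'rV[R]_n -> 'rV[R]_m) : Prop :=
  forall j, smooth_on O (fun x => f x ord0 j).

(* The maps are total; only their restrictions to [cdom] and [cimg] matter. *)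
Record chart (R : realType) (n : nat) (M : topologicalType) := Chart {
  cdom : set M;
  cmap : M -> 'rV[R]_n;
  cinv : 'rV[R]_n -> M;
  cdom_open : open cdom;
  cimg_open : open (cmap @` cdom);
  cmapK : forall x, cdom x -> cinv (cmap x) = x;
  cmap_continuous : forall x, cdom x -> {for x, continuous cmap};
  cinv_continuous : forall y, (cmap @` cdom) y -> {for y, continuous cinv}
}.

Definition cimg (R : realType) (n : nat) (M : topologicalType)
  (c : chart R n M) : set 'rV[R]_n := cmap c @` cdom c.

Definition is_atlas (R : realType) (n : nat) (M : topologicalType)
    (A : set (chart R n M)) : Prop :=
  (forall x, exists2 c, A c & cdom c x) /\
  (forall c c', A c -> A c' ->
     smooth_map_on (cmap c @` (cdom c `&` cdom c'))
                   (fun y => cmap c' (cinv c y))).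

HB.mixin Record isLieGroup (R : realType) (n : nat) G
    of Topological G & Group G := {
  atlas : set (chart R n G);
  atlasP : is_atlas atlas;
  lie_hausdorff : hausdorff_space G;
  lie_second_countable : @second_countable G;
  lie_mul_continuous : continuous (fun p : G * G => (p.1 * p.2)%g);
  lie_inv_continuous : continuous (fun x : G => x^-1%g);
  lie_mul_smooth : forall a b c, atlas a -> atlas b -> atlas c ->
    smooth_map_on
      [set z : 'rV[R]_(n + n) | [/\ cimg a (lsubmx z), cimg b (rsubmx z) &
         cdom c (cinv a (lsubmx z) * cinv b (rsubmx z))%g]]
      (fun z => cmap c (cinv a (lsubmx z) * cinv b (rsubmx z))%g);
  lie_inv_smooth : forall a b, atlas a -> atlas b ->
    smooth_map_on
      [set y | cimg a y /\ cdom b ((cinv a y)^-1)%g]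
      (fun y => cmap b ((cinv a y)^-1)%g)
}.

#[short(type="lieGroupType")]
HB.structure Definition LieGroup (R : realType) (n : nat) :=
  { G of isLieGroup R n G & Topological G & Group G }.

Section LieAlgebra.
Context {R : realType} {n : nat} (G : lieGroupType R n).
Implicit Types (f h : G -> R) (X : (G -> R) -> (G -> R)).

Definition smooth f : Prop :=
  forall c, (@atlas R n G) c -> smooth_on (cimg c) (fun y => f (cinv c y)).

(* Vector fields as derivations of C^oo(G); values of [X] at functions that
   are not smooth are irrelevant. *)
Definition vector_field X : Prop :=
  [/\ forall f, smooth f -> smooth (X f),
      forall (a : R) f h, smooth f -> smooth h ->
        forall x, X (fun y => a * f y + h y) x = a * X f x + X h x
    & forall f h, smooth f -> smooth h ->
        forall x, X (fun y => f y * h y) x = f x * X h x + X f x * h x].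

Definition left_invariant X : Prop :=
  forall (a : G) f, smooth f ->
    forall x, X (fun y => f (a * y)%g) x = X f (a * x)%g.

(* [lfield] identifies the vector space with the space of all left-invariant
   vector fields; [lfield v f x] is the derivative of [f] along the tangent
   vector [dl_x(v)]. *)
Record lieAlgebraOf := LieAlgebraOf {
  lie_space :> vectType R;
  lfield : lie_space -> (G -> R) -> (G -> R);
  bracket : lie_space -> lie_space -> lie_space;
  lfield_vector_field : forall v, vector_field (lfield v);
  lfield_left_invariant : forall v, left_invariant (lfield v);
  lfield_linear : forall (a : R) v w f, smooth f ->
    forall x, lfield (a *: v + w) f x = a * lfield v f x + lfield w f x;
  lfield_inj : forall v,
    (forall f, smooth f -> forall x, lfield v f x = 0) -> v = 0;
  lfield_surj : forall X, vector_field X -> left_invariant X ->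
    exists v, forall f, smooth f -> forall x, lfield v f x = X f x;
  bracketP : forall v w f, smooth f ->
    forall x, lfield (bracket v w) f x =
      lfield v (lfield w f) x - lfield w (lfield v f) x
}.

End LieAlgebra.

Arguments lfield {R n G l}.
Arguments bracket {R n G l}.

Notation "[l v , w ]" := (bracket v w) (at level 0, v, w at level 99,
  format "[l  v ,  w ]") : ring_scope.

Section AbsoluteContinuity.
Context {R : realType}.

Definition abs_cont (a b : R) (f : R -> R) : Prop :=
  forall eps : R, 0 < eps -> exists2 delta : R, 0 < delta &
    forall (m : nat) (l r : 'I_m -> R),
      (forall i, [/\ a <= l i, l i <= r i & r i <= b]) ->
      trivIset setT (fun i => `]l i, r i[%classic) ->
      \sum_(i < m) (r i - l i) < delta ->
      \sum_(i < m) `|f (r i) - f (l i)| < eps.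

(* On an interval: absolute continuity on every compact subinterval. *)
Definition abs_cont_on (Om : set R) (f : R -> R) : Prop :=
  forall a b, Om a -> Om b -> a <= b -> abs_cont a b f.

Definition ae_on (Om : set R) (P : R -> Prop) : Prop :=
  {ae (@lebesgue_measure R), forall t, Om t -> P t}.

End AbsoluteContinuity.

Section LeftInvariantProblem.
Context {R : realType} {n : nat} {G : lieGroupType R n} {g : lieAlgebraOf G}.
Implicit Types (q : {vspace g}) (Om : set R) (gam : R -> G) (u : R -> g)
  (psi : R -> 'Hom(g, R^o)) (F : g -> R).

Definition subalgebra (V : {vspace g}) : Prop :=
  forall x y, x \in V -> y \in V -> [l x, y] \in V.

Definition generates q : Prop :=
  forall V : {vspace g}, (q <= V)%VS -> subalgebra V -> V = fullv.

Definition normalizer q : set g :=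
  [set x | forall y, y \in q -> [l x, y] \in q].

Definition adapted_basis q (e1 e2 e3 : g) : Prop :=
  let e := [tuple e1; e2; e3; [l e1, e3]] in
  [/\ basis_of q [:: e1; e2; e3], basis_of fullv e,
      coord e ord_max [l e1, e2] = 0 & coord e ord_max [l e2, e3] = 0].

(* The values of [ip] outside [q] are irrelevant. *)
Definition scalar_product q (ip : g -> g -> R) : Prop :=
  [/\ forall x y, x \in q -> y \in q -> ip x y = ip y x,
      forall (a : R) x y z, x \in q -> y \in q -> z \in q ->
        ip (a *: x + y) z = a * ip x z + ip y z
    & forall x, x \in q -> x != 0 -> 0 < ip x x].

Definition sp_norm (ip : g -> g -> R) (u : g) : R := Num.sqrt (ip u u).

Definition orthonormal_basis q (ip : g -> g -> R) (e1 e2 e3 : g) : Prop :=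
  [/\ basis_of q [:: e1; e2; e3],
      [/\ ip e1 e1 = 1, ip e2 e2 = 1 & ip e3 e3 = 1]
    & [/\ ip e1 e2 = 0, ip e1 e3 = 0 & ip e2 e3 = 0]].

(* The exponential map: [s |-> expG (s v)] is the one-parameter subgroup with
   initial velocity [v]. *)
Definition is_exp_map (expG : g -> G) : Prop :=
  forall v : g,
    (forall s t : R, expG ((s + t) *: v) = (expG (s *: v) * expG (t *: v))%g) /\
    (forall (t : R) (f : G -> R), smooth f ->
       is_derive t 1 (fun s : R => f (expG (s *: v)))
         (lfield v f (expG (t *: v)))).

(* A curve is absolutely continuous iff its compositions with smooth functions
   are, and its velocity is tested on smooth functions. *)
Definition ac_curve Om gam : Prop :=
  forall f : G -> R, smooth f -> abs_cont_on Om (f \o gam).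

Definition has_velocity gam (t : R) (v : g) : Prop :=
  forall f : G -> R, smooth f ->
    is_derive t 1 (f \o gam) (lfield v f (gam t)).

Definition measurable_control Om u : Prop :=
  forall l : 'Hom(g, R^o), measurable_fun Om (fun t => (l (u t) : R)).

Definition unit_ball q F : set g := [set u | u \in q /\ F u <= 1].

Definition admissible_time q F (x y : G) (T : R) : Prop :=
  0 <= T /\ exists gam u,
    [/\ gam 0 = x /\ gam T = y, ac_curve `[0, T] gam,
        measurable_control `[0, T] u,
        forall t, `[0, T]%classic t -> unit_ball q F (u t)
      & ae_on `[0, T] (fun t => has_velocity gam t (u t))].

Definition is_metric_of q F (d : G -> G -> R) : Prop :=
  forall x y, admissible_time q F x y (d x y) /\
    forall T, admissible_time q F x y T -> d x y <= T.

(* Pontryagin Maximum Principle for the curve [gam] with control [u], covector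
   [psi] and constant [M]. *)
Definition pmp q F Om gam u psi (M : R) : Prop :=
  [/\ [/\ ac_curve Om gam, measurable_control Om u,
          forall t, Om t -> u t \in q
        & ae_on Om (fun t => has_velocity gam t (u t) /\ F (u t) = 1)],
      forall t, Om t -> psi t != 0,
      forall v, abs_cont_on Om (fun t => psi t v),
      0 <= M
    & ae_on Om (fun t =>
        (forall v, is_derive t 1 (fun s => psi s v : R)
                                 (psi t [l u t, v] : R)) /\
        (psi t (u t) = M /\
         forall w, unit_ball q F w -> psi t w <= M :> R))].

Definition extremal q F Om gam : Prop :=
  [/\ is_interval Om, Om !=set0,
      exists u psi M, pmp q F Om gam u psi M
    & forall Om' gam', is_interval Om' -> Om `<=` Om' ->
        (forall t, Om t -> gam' t = gam t) ->
        (exists u psi M, pmp q F Om' gam' u psi M) -> Om' = Om].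

Definition abnormal_wrt q F Om gam psi : Prop :=
  exists u, pmp q F Om gam u psi 0.

Definition normal_wrt q F Om gam psi : Prop :=
  exists u, exists2 M, 0 < M & pmp q F Om gam u psi M.

Definition abnormal_extremal q F Om gam : Prop :=
  extremal q F Om gam /\ exists psi, abnormal_wrt q F Om gam psi.

Definition nonstrongly_abnormal q F Om gam : Prop :=
  abnormal_extremal q F Om gam /\ exists psi, normal_wrt q F Om gam psi.

End LeftInvariantProblem.

(* Main.v *)
(* After normalization the curve is t |-> exp(t u) with u = sg e2, sg = 1 or -1, in the
   adapted orthonormal basis (e1, e2, e3), e4 = [e1, e3].  As [e2, q] lies in q, the
   annihilator of q, spanned by the dual covector of e4, is an eigenline of the coadjoint
   operator of u; this gives the abnormal covector exp(C t) e4^*.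
   A normal covector psi attains its maximum M over the unit ball at u, hence
   psi(e1) = psi(e3) = 0 and psi(e2) = sg M along the curve; differentiating psi(e1) and
   psi(e3) shows that [e2, e1] and [e2, e3] have no e2-component.  Conversely, if
   [e2, q] lies in <e1, e3>, the Jacobi identity shows that [e2, e4] is a multiple of e4, so
   the constant covector sg e2^* is annihilated by the coadjoint operator of u, hence normal.
   The control of a given extremal is determined almost everywhere by the curve, which
   requires left translates of smooth functions to be smooth. *)

Require Import Defs.
From HB Require Import structures.
From mathcomp Require Import all_boot all_order all_algebra.
From mathcomp Require Import all_classical all_reals all_analysis.
From mathcomp Require Import ring lra.

Set Implicit Arguments.
Unset Strict Implicit.
Unset Printing Implicit Defensive.

Import Order.TTheory GRing.Theory Num.Theory.
Import numFieldNormedType.Exports.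

Local Open Scope classical_set_scope.
Local Open Scope ring_scope.

(** * Functions of class $C^k$ on subsets of $\mathbb{R}^n$ *)

Lemma differentiable_near_eq {R : numFieldType} {V W : normedModType R}
    (f h : V -> W) (x : V) :
  (\forall y \near x, f y = h y) -> differentiable f x -> differentiable h x.
Proof.
move=> fh fd.
have dfc : continuous ('d f x) by exact: diff_continuous.
have key : h \o shift x = cst (h x) + 'd f x +o_ (0 : V) id.
  apply/eqaddoP => eps eps0; have /eqaddoE/eqaddoP/(_ _ eps0) := diff_locally fd.
  move: fh (fh); rewrite {1}(near_shift 0) subr0 => fh0 /nbhs_singleton <-.
  by apply: filterS2 fh0 => y /=; rewrite !fctE => ->.
by apply/diff_locallyP; rewrite (diff_unique dfc key).
Qed.

Section SmoothCalculus.
Context {R : realType} {n : nat}.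
Implicit Types (O U : set 'rV[R]_n) (f h : 'rV[R]_n -> R) (k : nat).

Lemma Ck_on_near k O f h :
  (forall x, O x -> \forall y \near x, f y = h y) -> Ck_on k O f -> Ck_on k O h.
Proof.
elim: k f h => [|k IHk] f h fh /=.
  move=> fc x Ox; have fhx := fh x Ox.
  rewrite /prop_for /continuous_at -(nbhs_singleton fhx).
  exact: cvg_trans (near_eq_cvg fhx) (fc x Ox).
move=> [fd Df]; split=> [x Ox|v].
  by apply: differentiable_near_eq (fd x Ox); exact: fh.
(* Agreement near [x] is agreement near every point close to [x], so the directional derivatives
   agree near [x] as well. *)
apply: IHk (Df v) => x Ox; have /near_join := fh x Ox.
by apply: filterS => y; exact: near_eq_derive.
Qed.

Lemma Ck_on_local k O f :
  (forall x, O x -> exists2 U, U x & Ck_on k U f) -> Ck_on k O f.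
Proof.
elim: k f => [|k IHk] f /= Of.
  by move=> x /Of[U Ux]; apply.
split=> [x /Of[U Ux []]|v]; first by move=> + _; apply.
by apply: IHk => x /Of[U Ux [_ /(_ v)]]; exists U.
Qed.

Lemma Ck_onW k O f : Ck_on k.+1 O f -> Ck_on k O f.
Proof.
elim: k f => [|k IHk] f [fd Df].
  by move=> x Ox; exact/differentiable_continuous/fd.
by split=> // v; apply: IHk; exact: Df.
Qed.

Lemma Ck_on_cst k O (a : R) : Ck_on k O (fun=> a).
Proof.
elim: k a => [|k IHk] a /=; first by move=> x _; exact: cst_continuous.
split=> [x _|v]; first exact: differentiable_cst.
under [X in Ck_on k O X]eq_fun do rewrite derive_cst.
exact: IHk.
Qed.

Lemma Ck_on_coord k O (j : 'I_n) : Ck_on k O (fun x => x ord0 j).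
Proof.
case: k => [|k] /=.
  by move=> x _; exact/differentiable_continuous/differentiable_coord.
split=> [x _|v]; first exact: differentiable_coord.
rewrite (_ : (fun x => _) = fun=> v ord0 j); first exact: Ck_on_cst.
apply/funext => x; have : derivable id x v by exact: derivable_id.
by move=> /(derive_mx) /matrixP/(_ ord0 j); rewrite derive_id mxE => ->.
Qed.

Lemma Ck_onD k O f h : open O ->
  Ck_on k O f -> Ck_on k O h -> Ck_on k O (fun x => f x + h x).
Proof.
move=> oO; elim: k f h => [|k IHk] f h /=.
  by move=> fc hc x Ox; apply: continuousD; [exact: fc|exact: hc].
move=> [fd Df] [hd Dh]; split=> [x Ox|v].
  by apply: differentiableD; [exact: fd|exact: hd].
apply: (@Ck_on_near _ _ (fun x => 'D_v f x + 'D_v h x)); last exact: IHk.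
move=> x Ox; near=> y; rewrite deriveD //; apply: diff_derivable.
  by apply: fd; near: y; exact: open_nbhs_nbhs.
by apply: hd; near: y; exact: open_nbhs_nbhs.
Unshelve. all: by end_near. Qed.

Lemma Ck_onM k O f h : open O ->
  Ck_on k O f -> Ck_on k O h -> Ck_on k O (fun x => f x * h x).
Proof.
move=> oO; elim: k f h => [|k IHk] f h.
  by move=> fc hc x Ox; apply: continuousM; [exact: fc|exact: hc].
move=> fS hS; have [[fd Df] [hd Dh]] := (fS, hS); split=> [x Ox|v].
  by apply: differentiableM; [exact: fd|exact: hd].
apply: (@Ck_on_near _ _ (fun x => f x * 'D_v h x + h x * 'D_v f x)).
  move=> x Ox; near=> y; rewrite deriveM //; apply: diff_derivable.
    by apply: fd; near: y; exact: open_nbhs_nbhs.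
  by apply: hd; near: y; exact: open_nbhs_nbhs.
by apply: Ck_onD => //; apply: IHk; by [exact: Ck_onW|exact: Df|exact: Dh].
Unshelve. all: by end_near. Qed.

Lemma Ck_on_sum k O m (f : 'I_m -> 'rV[R]_n -> R) : open O ->
  (forall i, Ck_on k O (f i)) -> Ck_on k O (fun x => \sum_(i < m) f i x).
Proof.
move=> oO fk.
have -> : (fun x => \sum_(i < m) f i x) = \sum_(i < m) f i.
  by apply/funext => x; rewrite fct_sumE.
elim/big_ind: _ => // [|f1 f2]; first exact: Ck_on_cst.
exact: Ck_onD.
Qed.

Lemma differentiable_rowP m (g : 'rV[R]_n -> 'rV[R]_m) (x : 'rV[R]_n) :
  (forall j, differentiable (fun y => g y ord0 j) x) -> differentiable g x.
Proof.
move=> gd.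
have -> : g = \sum_(j < m) (fun y => g y ord0 j *: delta_mx ord0 j).
  by apply/funext => y; rewrite fct_sumE [LHS]row_sum_delta.
by apply: differentiable_sum => j; exact: differentiableZl.
Qed.

(** The chain rule in partial derivatives: as a sum of products of scalar functions, the right-hand
    side is within reach of [Ck_on_sum] and [Ck_onM]. *)
Lemma derive_comp_row m (f : 'rV[R]_m -> R) (g : 'rV[R]_n -> 'rV[R]_m)
    (x v : 'rV[R]_n) :
  (forall j, differentiable (fun y => g y ord0 j) x) ->
  differentiable f (g x) ->
  'D_v (f \o g) x =
  \sum_(j < m) 'D_(delta_mx ord0 j) f (g x) * 'D_v (fun y => g y ord0 j) x.
Proof.
move=> gj fd; have gd := differentiable_rowP gj.
rewrite deriveE; last exact: differentiable_comp.
rewrite diff_comp //= -(deriveE v gd) [X in 'd f _ X]row_sum_delta linear_sum /=.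
apply: eq_bigr => j _; rewrite linearZ /= -deriveE // mulrC; congr (_ * _).
have : derivable g x v by exact: diff_derivable.
by move=> /derive_mx ->; rewrite mxE.
Qed.

(** Induction on the order, for all smooth outer functions at once: by the chain rule a derivative
    of the composite is built from partial derivatives of [f], again smooth and composed with [g],
    and from derivatives of [g]. *)
Lemma smooth_on_comp m O (Q : set 'rV[R]_m) (f : 'rV[R]_m -> R)
    (g : 'rV[R]_n -> 'rV[R]_m) : open O ->
  (forall x, O x -> Q (g x)) -> smooth_on Q f -> smooth_map_on O g ->
  smooth_on O (fun x => f (g x)).
Proof.
move=> oO OQ + gs k.
have gd j x : O x -> differentiable (fun y => g y ord0 j) x.
  by have [+ _] := gs j 1%N; apply.
elim: k f => [|k IHk] f fs; have [fd _] := fs 1%N.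
  move=> x Ox; apply: differentiable_continuous; apply: differentiable_comp.
    by apply: differentiable_rowP => j; exact: gd.
  exact/fd/OQ.
split=> [x Ox|v].
  apply: differentiable_comp; last exact/fd/OQ.
  by apply: differentiable_rowP => j; exact: gd.
apply: (@Ck_on_near _ _ (fun x => \sum_(j < m) 'D_(delta_mx ord0 j) f (g x) *
                           'D_v (fun y => g y ord0 j) x)).
  move=> x Ox; near=> y.
  have Oy : O y by near: y; exact: open_nbhs_nbhs.
  by rewrite -derive_comp_row // => [j|]; [exact: gd|exact/fd/OQ].
apply: Ck_on_sum => // j; apply: Ck_onM => //.
  apply: (IHk (fun y => 'D_(delta_mx ord0 j) f y)) => i.
  by have [_] := fs i.+1; apply.
by have [_] := gs j k.+1; apply.
Unshelve. all: by end_near. Qed.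

End SmoothCalculus.

(** * Left translations of smooth functions *)

Section LieGroupCalculus.
Context {R : realType} {n : nat} {G : lieGroupType R n}.

(** In charts, left translation by [a] is the smooth multiplication map restricted to the slice
    whose first argument is frozen at the coordinates of [a]. *)
Lemma smooth_left_translate (a : G) (f : G -> R) :
  smooth f -> smooth (fun x => f (a * x)%g).
Proof.
move=> fs c Ac k; apply: Ck_on_local => _ [x0 cx0 <-].
have [ca Aca caa] := (atlasP (s := G)).1 a.
have [b Ab bax] := (atlasP (s := G)).1 (a * x0)%g.
pose U := [set y | cimg c y /\ cdom b (a * cinv c y)%g].
have oc : open (cimg c) by exact: cimg_open.
have oU : open U.
  rewrite openE => y [cy byU]; apply: filterI.
    exact: open_nbhs_nbhs (conj oc cy).
  have : {for y, continuous (fun z => (a * cinv c z)%g)}.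
    apply: (@continuous2_cvg _ _ _ _ (nbhs y) _ (fun _ => a) (cinv c) (fun x z => x * z)%g).
    - exact: (@lie_mul_continuous R n G (a, cinv c y)).
    - exact: cvg_cst.
    - exact: cinv_continuous.
  by apply; exact: open_nbhs_nbhs (conj (cdom_open b) byU).
exists U; first by split; [exists x0|rewrite cmapK].
pose al := cmap ca a.
have cal : cinv ca al = a by rewrite cmapK.
pose mulb (z : 'rV[R]_(n + n)) :=
  cmap b (cinv ca (lsubmx z) * cinv c (rsubmx z))%g.
have gs : smooth_map_on U (fun y => mulb (row_mx al y)).
  move=> j; apply: (@smooth_on_comp _ _ _ U _ (fun z => mulb z ord0 j) (row_mx al) oU _
    (lie_mul_smooth _ _ _ Aca Ac Ab j)).
    move=> y [cy byU] /=; rewrite row_mxKl row_mxKr cal; split=> //.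
    by exists a.
  move=> i l; case: (split_ordP i) => i' ->.
    under eq_fun do rewrite row_mxEl.
    exact: Ck_on_cst.
  under eq_fun do rewrite row_mxEr.
  exact: Ck_on_coord.
have bU y : U y -> mulb (row_mx al y) = cmap b (a * cinv c y)%g.
  by move=> _; rewrite /mulb row_mxKl row_mxKr cal.
(* On the open set [U] the translate equals [f] read in the chart [b], composed with the translation
   read in [c] and [b]. *)
apply: Ck_on_near (smooth_on_comp oU _ (fs b Ab) gs k) => /= y Uy; last first.
  by rewrite bU //; exists (a * cinv c y)%g => //; case: Uy.
apply: filterS (open_nbhs_nbhs (conj oU Uy)) => z Uz.
by rewrite bU // cmapK //; case: Uz.
Qed.

(** * Left-invariant fields and the Lie bracket *)

Context {g : lieAlgebraOf G}.
Implicit Types (u v w : g) (f : G -> R).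

Lemma smooth_lfield v f : smooth f -> smooth (lfield v f).
Proof. by have [+ _ _] := lfield_vector_field v; apply. Qed.

Lemma lfield_comb v (a : R) f h x : smooth f -> smooth h ->
  lfield v (fun y => a * f y + h y) x = a * lfield v f x + lfield v h x.
Proof. by have [_ + _] := lfield_vector_field v => /[apply] /[apply]; apply. Qed.

Lemma lfieldD v w f x : smooth f -> lfield (v + w) f x = lfield v f x + lfield w f x.
Proof. by move=> fs; rewrite -[v]scale1r lfield_linear // mul1r scale1r. Qed.

Lemma lfield0 f x : smooth f -> lfield (0 : g) f x = 0.
Proof.
by move=> fs; rewrite -(addNr (0 : g)) -scaleN1r lfield_linear // mulN1r addNr.
Qed.

Lemma lfieldZ (a : R) v f x : smooth f -> lfield (a *: v) f x = a * lfield v f x.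
Proof. by move=> fs; rewrite -[_ *: _]addr0 lfield_linear // lfield0 // addr0. Qed.

Lemma lfieldB v w f x : smooth f -> lfield (v - w) f x = lfield v f x - lfield w f x.
Proof. by move=> fs; rewrite -scaleN1r lfieldD // lfieldZ // mulN1r. Qed.

(** Through this, an identity in the Lie algebra becomes an identity between derivations applied to
    a smooth function. *)
Lemma lfield_eq v w :
  (forall f, smooth f -> forall x, lfield v f x = lfield w f x) -> v = w.
Proof.
move=> vw; apply/subr0_eq/lfield_inj => f fs x.
by rewrite lfieldB // vw // subrr.
Qed.

(* The function [y |-> f (a y)] is smooth, so equality at one point spreads to the
   whole group by left invariance. *)
Lemma lfield_pt_inj (a : G) v w :
  (forall f, smooth f -> lfield v f a = lfield w f a) -> v = w.
Proof.
move=> vw; apply: lfield_eq => f fs x.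
have := vw _ (smooth_left_translate (x * a^-1)%g fs).
by rewrite !lfield_left_invariant // divgK.
Qed.

Lemma lfield_subE v f h x : smooth f -> smooth h ->
  lfield v (fun y => f y - h y) x = lfield v f x - lfield v h x.
Proof.
move=> fs hs; rewrite (_ : (fun y => _) = fun y => -1 * h y + f y).
  by rewrite lfield_comb // mulN1r addrC.
by apply/funext => y; rewrite mulN1r addrC.
Qed.

Lemma bracketC v w : [l v, w] = - [l w, v].
Proof.
apply: lfield_eq => f fs x; rewrite -scaleN1r lfieldZ // !bracketP //.
by rewrite mulN1r opprB.
Qed.

Lemma bracketxx v : [l v, v] = 0.
Proof. by apply: lfield_eq => f fs x; rewrite bracketP // subrr lfield0. Qed.

Lemma bracket_linearr u : linear (bracket u : g -> g).
Proof.
move=> a v w; apply: lfield_eq => f fs x.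
have sl (z : g) : smooth (lfield z f) by exact: smooth_lfield.
rewrite lfield_linear // !bracketP // lfield_linear //.
have -> : lfield (a *: v + w) f = fun y => a * lfield v f y + lfield w f y.
  by apply/funext => y; exact: lfield_linear.
by rewrite lfield_comb //; ring.
Qed.

HB.instance Definition _ u :=
  GRing.isLinear.Build R g g _ (bracket u) (bracket_linearr u).

Lemma bracketZl (a : R) v w : [l a *: v, w] = a *: [l v, w].
Proof. by rewrite bracketC linearZ -scalerN -bracketC. Qed.

Lemma bracketDl u v w : [l u + v, w] = [l u, w] + [l v, w].
Proof. by rewrite bracketC linearD opprD -!bracketC. Qed.

Lemma bracket_jacobi u v w : [l u, [l v, w]] = [l [l u, v], w] + [l v, [l u, w]].
Proof.
apply: lfield_eq => f fs x.
have sl (z : g) h : smooth h -> smooth (lfield z h) by move=> ?; exact: smooth_lfield.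
(* Stated as an equality of functions, the commutator formula can be rewritten under an outer
   derivation; Jacobi then reduces to cancellation of triple products. *)
have bE (y z : g) h : smooth h ->
    lfield [l y, z] h = fun x => lfield y (lfield z h) x - lfield z (lfield y h) x.
  by move=> hs; apply/funext => t; rewrite bracketP.
have sf (z : g) : smooth (lfield z f) by exact: sl.
rewrite lfieldD // !bracketP // !bE // !lfield_subE; do ?exact: sl.
by ring.
Qed.

End LieGroupCalculus.

(** * Absolute continuity and almost-everywhere statements on the line *)

Section RealAnalysis.
Context {R : realType}.
Implicit Types (f : R -> R) (a b t : R).

Lemma is_derive_continuous f t (df : R) : is_derive t (1 : R) f df -> {for t, continuous f}.
Proof.
by move=> [fd _]; apply: differentiable_continuous; apply/derivable1_diffP.
Qed.

(** The mean value theorem and the maximum of the derivative on the compact interval give a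
    Lipschitz bound. *)
Lemma C1_abs_cont (f df : R -> R) a b : a <= b ->
  (forall t, is_derive t (1 : R) f (df t)) -> continuous df -> abs_cont a b f.
Proof.
move=> ab fd dfc.
have ndfc : continuous (fun t => `|df t|).
  by move=> t; apply: cvg_norm; exact: dfc.
have [c cab maxc] := EVT_max ab (continuous_subspaceT ndfc).
(* Adding 1 keeps [K] positive, so that [eps / K] is a valid choice of [delta]. *)
pose K := `|df c| + 1.
have K0 : 0 < K by rewrite ltr_wpDl.
have fK l r : a <= l -> l <= r -> r <= b -> `|f r - f l| <= K * (r - l).
  move=> al lr rb.
  have fc : {within `[l, r], continuous f}.
    apply: continuous_subspaceT => t; exact: is_derive_continuous (fd t).
  have [t + ->] := MVT_segment lr (fun t _ => fd t) fc.
  rewrite in_itv /= => /andP[lt tr].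
  rewrite normrM [X in _ * X]ger0_norm ?subr_ge0 // ler_wpM2r ?subr_ge0 //.
  apply: ler_wpDr => //; apply: maxc.
  by rewrite in_itv /= (le_trans al lt) (le_trans tr rb).
move=> eps eps0; exists (eps / K); first by rewrite divr_gt0.
move=> m l r lr _; rewrite ltr_pdivlMr // mulrC; apply: le_lt_trans.
rewrite mulr_sumr; apply: ler_sum => i _.
by have [? ? ?] := lr i; exact: fK.
Qed.

Lemma abs_cont_continuous f : abs_cont_on [set: R] f -> continuous f.
Proof.
move=> fac t; apply/cvgrPdist_lt => eps eps0.
have t1 : t - 1 <= t + 1 by lra.
have [del del0 fdel] := fac (t - 1) (t + 1) I I t1 eps eps0.
have key l r : t - 1 <= l -> l <= r -> r <= t + 1 -> r - l < del ->
    `|f r - f l| < eps.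
  move=> tl lr rt rl.
  (* A family of one interval turns absolute continuity into uniform continuity. *)
  have := fdel 1%N (fun=> l) (fun=> r) (fun=> And3 tl lr rt).
  rewrite !big_ord1; apply=> //.
  by move=> i j _ _ _; rewrite !ord1.
near=> s.
have : `|t - s| < Num.min 1 del.
  by near: s; apply: (@cvgr_dist_lt _ R^o) => //; rewrite lt_min ltr01.
rewrite lt_min => /andP[/ltr_normlP[s1 s2] /ltr_normlP[d1 d2]].
by have [ts|ts] := leP t s; [rewrite distrC|]; apply: key; lra.
Unshelve. all: by end_near. Qed.

(** Otherwise the interval, of measure [b - a], would be negligible. *)
Lemma ae_itv (P : R -> Prop) a b : {ae (@lebesgue_measure R), forall t, P t} ->
  a < b -> exists2 t, a < t < b & P t.
Proof.
move=> aeP ab; apply: contrapT => nP.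
have : (@lebesgue_measure R) `]a, b[%classic = 0%E.
  apply/negligibleP; first exact: measurable_itv.
  apply: negligibleS aeP => t /=; rewrite in_itv /= => tab Pt.
  by apply: nP; exists t.
rewrite lebesgue_measure_itv /= lte_fin ab => /eqP.
by rewrite -EFinB eqe subr_eq0 gt_eqF.
Qed.

Lemma ae_eq_continuous f (c : R) : continuous f ->
  {ae (@lebesgue_measure R), forall t, f t = c} -> forall t, f t = c.
Proof.
move=> fc fae t; apply/eqP/negPn/negP => ftc.
have : \forall s \near t, f s != c.
  apply: (fc t [set y : R | y != c]).
  by apply: open_nbhs_nbhs; split=> //; exact: open_neq.
move=> /nbhs_ballP[e /= e0 te].
have te' : t - e < t + e by rewrite ltrD2l gtrN.
have [s /andP[s1 s2] fs] := ae_itv fae te'.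
have := te s; rewrite /ball /= ltr_distlC s1 s2 => /(_ isT).
by rewrite fs eqxx.
Qed.

End RealAnalysis.

(** * One-parameter subgroups as extremals *)

Section OneParameterExtremals.
Context {R : realType} {n : nat} {G : lieGroupType R n} {g : lieAlgebraOf G}.
Context (expG : g -> G).
Context (expG_exp : is_exp_map expG).
Implicit Types (u v w : g) (psi : R -> 'Hom(g, R^o)).

Lemma exp_has_velocity u (t : R) : has_velocity (fun t => expG (t *: u)) t u.
Proof. by move=> f fs; have [_ /(_ t f fs)] := expG_exp u. Qed.

Lemma exp_ac_curve (Om : set R) u : ac_curve Om (fun t => expG (t *: u)).
Proof.
move=> f fs a b _ _ ab.
apply: (C1_abs_cont ab) (fun t => exp_has_velocity u t fs) _ => t.
exact: is_derive_continuous (exp_has_velocity u t (smooth_lfield u fs)).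
Qed.

Lemma has_velocity_unique (gam : R -> G) (t : R) v w :
  has_velocity gam t v -> has_velocity gam t w -> v = w.
Proof.
move=> gv gw; apply: (@lfield_pt_inj _ _ _ _ (gam t)) => f fs.
by have [[_ <-] [_ <-]] := (gv f fs, gw f fs).
Qed.

(** With a constant control every condition holds at all times. The derivative of [psi t v] is
    [psi t] at [[l u, v]], itself differentiable in [t], hence continuous, which gives absolute
    continuity. *)
Lemma pmp_exp (q : {vspace g}) (F : g -> R) u psi (M : R) :
  u \in q -> F u = 1 -> (forall t, psi t != 0) ->
  (forall v (t : R), is_derive t 1 (fun s => psi s v : R) (psi t [l u, v] : R)) ->
  0 <= M -> (forall t, psi t u = M) ->
  (forall t w, unit_ball q F w -> psi t w <= M :> R) ->
  pmp q F [set: R] (fun t => expG (t *: u)) (fun=> u) psi M.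
Proof.
move=> uq Fu psi0 dpsi M0 psiM psile; split=> //.
- split=> //; first exact: exp_ac_curve.
  by apply: aeW => t _; split=> //; exact: exp_has_velocity.
- move=> v a b _ _ ab; apply: (C1_abs_cont ab (dpsi v)) => t.
  exact: is_derive_continuous (dpsi _ t).
- by apply: aeW => t _; split=> [v|]; [exact: dpsi|split=> // w; exact: psile].
Qed.

(** Maximality is automatic: no interval properly contains the line. *)
Lemma extremal_setT (q : {vspace g}) (F : g -> R) (gam : R -> G) u psi (M : R) :
  pmp q F [set: R] gam (fun=> u) psi M -> extremal q F [set: R] gam.
Proof.
move=> gp; split=> //; first by exists 0.
  by exists (fun=> u), psi, M.
by move=> Om' gam' _ TOm _ _; apply/seteqP; split.
Qed.

End OneParameterExtremals.

(* Equality case of Cauchy-Schwarz: [(p1, p2, p3)] has norm at most [M] and takes the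
   value [M] at the unit vector [(0, sg, 0)]. *)
Lemma covector_max_eq {R : realType} (p1 p2 p3 sg M : R) : 0 < M ->
  sg ^+ 2 = 1 -> sg * p2 = M ->
  (forall a b c, a ^+ 2 + b ^+ 2 + c ^+ 2 <= 1 -> a * p1 + b * p2 + c * p3 <= M) ->
  [/\ p1 = 0, p2 = sg * M & p3 = 0].
Proof.
move=> M0 sg1 p2M pmax.
have p2E : p2 = sg * M by rewrite -p2M mulrA -expr2 sg1 mul1r.
have p2sq : p2 ^+ 2 = M ^+ 2 by rewrite p2E exprMn sg1 mul1r.
pose S := p1 ^+ 2 + p2 ^+ 2 + p3 ^+ 2; pose N := Num.sqrt S.
have S0 : 0 < S by rewrite /S p2sq; have := exprn_gt0 2 M0; nra.
have N0 : 0 < N by rewrite sqrtr_gt0.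
have NS : N ^+ 2 = S by rewrite sqr_sqrtr // ltW.
have NM : N <= M.
  (* The test vector is the normalized covector $p/N$, where the covector takes the value [N]. Then
     $N^2 \le M^2 = p_2^2$ leaves no room for [p1] and [p3]. *)
  have -> : N = p1 / N * p1 + p2 / N * p2 + p3 / N * p3.
    by rewrite -[LHS](mulfK (lt0r_neq0 N0)) -expr2 NS /S; field; rewrite gt_eqF.
  apply: pmax; rewrite !expr_div_n NS -!mulrDl -/S divff //.
  by rewrite gt_eqF.
have : S <= M ^+ 2 by rewrite -NS lerXn2r // nnegrE ltW.
rewrite /S p2sq => pM.
have := sqr_ge0 p1; have := sqr_ge0 p3 => h3 h1.
split=> //; apply/eqP; rewrite -sqrf_eq0; apply/eqP; lra.
Qed.

(** * Coordinates and spans *)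

Section Coordinates.
Context {R : realType} {V : vectType R}.
Implicit Types (q : {vspace V}) (v x : V).

Lemma dual_basis m (X : m.-tuple V) : basis_of fullv X ->
  exists phi : 'I_m -> 'Hom(V, R^o),
    (forall i j : 'I_m, phi j X`_i = (i == j)%:R) /\
    (forall v, v = \sum_i phi i v *: X`_i).
Proof.
move=> bX; exists (fun i => linfun (coord X i : V -> R^o)); split=> [i j|v].
  by rewrite lfunE; exact: coord_free i j (basis_free bX).
under eq_bigr do rewrite lfunE /=.
exact: coord_basis bX (memvf v).
Qed.

Lemma span2P v1 v2 x : x \in <<[:: v1; v2]>>%VS <->
  exists a b : R, x = a *: v1 + b *: v2.
Proof.
split=> [/(@coord_span _ _ _ [tuple v1; v2])|[a [b ->]]].
  by rewrite !big_ord_recl big_ord0 addr0 /= => ->; do 2!eexists.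
by rewrite memvD // memvZ // memv_span // !inE eqxx ?orbT.
Qed.

Lemma basis3P q v1 v2 v3 x : basis_of q [:: v1; v2; v3] -> x \in q <->
  exists a b c : R, x = a *: v1 + b *: v2 + c *: v3.
Proof.
move=> /span_basis <-; split=> [/(@coord_span _ _ _ [tuple v1; v2; v3])|].
  by rewrite !big_ord_recl big_ord0 addr0 addrA /= => ->; do 3!eexists.
by move=> [a [b [c ->]]]; rewrite !memvD // memvZ // memv_span // !inE eqxx ?orbT.
Qed.

End Coordinates.

(** * The extremal along the normalizer direction, in an adapted orthonormal basis *)

Section NormalizerExtremal.
Context {R : realType} {n : nat} {G : lieGroupType R n} {g : lieAlgebraOf G}.
Context (q : {vspace g}) (ip : g -> g -> R) (e1 e2 e3 : g).
Context (ip_sp : scalar_product q ip).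
Context (e_orthonormal : orthonormal_basis q ip e1 e2 e3).

Let e_q a b c : a *: e1 + b *: e2 + c *: e3 \in q.
Proof. by have [/basis3P bq _ _] := e_orthonormal; apply/bq; do 3!eexists. Qed.

Lemma orthonormal_sp_norm (a b c : R) :
  sp_norm ip (a *: e1 + b *: e2 + c *: e3) = Num.sqrt (a ^+ 2 + b ^+ 2 + c ^+ 2).
Proof.
have [ip_sym ip_lin _] := ip_sp.
have [bq [ip11 ip22 ip33] [ip12 ip13 ip23]] := e_orthonormal.
have [q1 q2 q3] : [/\ e1 \in q, e2 \in q & e3 \in q].
  by rewrite -(span_basis bq) !memv_span // !inE eqxx ?orbT.
have ipl (z : g) : z \in q -> ip (a *: e1 + b *: e2 + c *: e3) z =
    a * ip e1 z + b * ip e2 z + c * ip e3 z.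
  have q0 : (0 : g) \in q by exact: mem0v.
  (* Linearity with $a = 1$ and $x = y = 0$ gives [ip 0 z] equal to twice itself. *)
  move=> zq; have ip0 : ip 0 z = 0.
    have := ip_lin 1 0 0 z q0 q0 zq.
    by rewrite scaler0 addr0 mul1r => /eqP; rewrite -subr_eq subrr => /eqP.
  by rewrite -addrA !ip_lin ?memvD ?memvZ // -[c *: e3]addr0 ip_lin // ip0; ring.
rewrite /sp_norm ipl ?e_q // (ip_sym e1) ?(ip_sym e2 (_ + _)) ?(ip_sym e3 (_ + _)) ?e_q //.
rewrite !ipl //.
rewrite !(ip_sym e2 e1, ip_sym e3 e1, ip_sym e3 e2) // ip11 ip22 ip33 ip12 ip13 ip23.
by congr Num.sqrt; ring.
Qed.


Context (expG : g -> G) (expG_exp : is_exp_map expG).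
Context (e_adapted : adapted_basis q e1 e2 e3) (e2_N : normalizer q e2).
Context (sg : R) (sg_sq : sg ^+ 2 = 1).

Let u := sg *: e2.
Let F := sp_norm ip.
Let gam (t : R) := expG (t *: u).
Let e4 := [l e1, e3].

Let e_in : [/\ e1 \in q, e2 \in q & e3 \in q].
Proof.
by have [/span_basis <- _ _] := e_orthonormal; rewrite !memv_span // !inE eqxx ?orbT.
Qed.

Let u_q : u \in q.
Proof. by apply: memvZ; case: e_in. Qed.

Let F_u : F u = 1.
Proof.
have := orthonormal_sp_norm 0 sg 0.
by rewrite !scale0r add0r addr0 -/u -/F => ->; rewrite expr0n add0r addr0 sg_sq sqrtr1.
Qed.

Let u_N v : v \in q -> [l u, v] \in q.
Proof. by move=> vq; rewrite bracketZl memvZ // e2_N. Qed.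

(** The coordinates in the adapted basis: [p4] spans the annihilator of [q] and gives the abnormal
    covector, [p2] gives the normal one. *)
Let adapted_dual : exists p1 p2 p3 p4 : 'Hom(g, R^o),
  [/\ forall v, v = p1 v *: e1 + p2 v *: e2 + p3 v *: e3 + p4 v *: e4,
      [/\ p2 e1 = 0, p2 e2 = 1, p2 e3 = 0 & p2 e4 = 0],
      forall v, v \in q -> p4 v = 0 & p4 e4 = 1].
Proof.
have [bq _ _] := e_orthonormal; have [_ b4 _ _] := e_adapted.
have [phi [phiE dec]] := dual_basis b4.
have pE i (hi : (i < 4)%N) j (hj : (j < 4)%N) :
    phi (Ordinal hj) (nth 0 [:: e1; e2; e3; e4] i) = (i == j)%:R.
  exact: (phiE (Ordinal hi) (Ordinal hj)).
pose P i (hi : (i < 4)%N) := phi (Ordinal hi).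
(* Indices start at 0: [@P 0%N] is the coordinate along [e1], [@P 3%N] the one along [e4]. *)
exists (@P 0%N isT), (@P 1%N isT), (@P 2%N isT), (@P 3%N isT); split.
- move=> v; rewrite {1}(dec v) !big_ord_recl big_ord0 addr0 /= !addrA.
  have phP i (hi : (i < 4)%N) (o : 'I_4) : val o = i -> phi o = @P i hi.
    by move=> oi; congr phi; exact: val_inj.
  rewrite (phP 0%N isT ord0) // (phP 1%N isT (lift ord0 ord0)) //.
  rewrite (phP 2%N isT (lift ord0 (lift ord0 ord0))) //.
  by rewrite (phP 3%N isT (lift ord0 (lift ord0 (lift ord0 ord0)))).
- by split; [exact: (pE 0%N isT 1%N isT)|exact: (pE 1%N isT 1%N isT)
            |exact: (pE 2%N isT 1%N isT)|exact: (pE 3%N isT 1%N isT)].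
- move=> v /(basis3P _ bq)[a [b [d ->]]]; rewrite !linearD !linearZ /=.
  rewrite (pE 0%N isT 3%N isT) (pE 1%N isT 3%N isT) (pE 2%N isT 3%N isT).
  by rewrite !scaler0 !addr0.
- exact: (pE 3%N isT 3%N isT).
Qed.

Lemma abnormal_exp : abnormal_extremal q F [set: R] gam.
Proof.
have [p1 [p2 [p3 [p4 [dec _ p4q p4e4]]]]] := adapted_dual.
have [q1 q2 q3] := e_in.
pose C : R := p4 [l u, e4].
(* As [[l u, _]] maps [q] into [q], where [p4] vanishes, only the [e4]-component of [v]
   contributes. *)
have p4u v : p4 [l u, v] = C * p4 v.
  rewrite {1}(dec v) !linearD !linearZ /= (p4q _ (u_N q1)) (p4q _ (u_N q2)) (p4q _ (u_N q3)).
  by rewrite !scaler0 !add0r mulrC.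
(* On multiples of [p4] the adjoint equation is the scalar equation $y' = Cy$, whose exponential
   solution never vanishes. *)
pose psi (t : R) : 'Hom(g, R^o) := expR (C * t) *: p4.
have gp : pmp q F [set: R] gam (fun=> u) psi 0.
  apply: pmp_exp => //.
  - move=> t; apply/eqP => /(congr1 (fun h : 'Hom(g, R^o) => h e4 : R)).
    rewrite scale_lfunE zero_lfunE p4e4 => /eqP.
    by rewrite scaler_eq0 gt_eqF ?expR_gt0 // oner_eq0.
  - move=> v t; rewrite scale_lfunE p4u.
    rewrite (_ : (fun s => _) = fun s => expR (C * s) * p4 v); last first.
      by apply/funext => s; rewrite scale_lfunE.
    have dC : is_derive t (1 : R) (fun s => C * s : R) C.
      by apply: is_derive_eq; rewrite /GRing.scale /= mulr1.
    have dE := is_derive1_comp (is_derive_expR (C * t)) dC.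
    have -> : (fun s => expR (C * s) * p4 v) = p4 v *: (expR \o *%R C) :> (R -> R).
      by apply/funext => s; rewrite mulrC.
    by apply: is_derive_eq (is_deriveZ _ dE) _; rewrite /GRing.scale /=; ring.
  - by move=> t; rewrite scale_lfunE p4q // scaler0.
  - by move=> t w [wq _]; rewrite scale_lfunE p4q // scaler0.
split; first exact: extremal_setT gp.
by exists psi, (fun=> u).
Qed.

Lemma normal_exp : (forall x, x \in q -> [l e2, x] \in <<[:: e1; e3]>>%VS) ->
  exists psi, normal_wrt q F [set: R] gam psi.
Proof.
move=> e2q; have [p1 [p2 [p3 [p4 [dec [p21 p22 p23 p24] _ _]]]]] := adapted_dual.
have [q1 q2 q3] := e_in; have [bq _ _] := e_orthonormal.
have p2span x : x \in <<[:: e1; e3]>>%VS -> p2 x = 0.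
  by move=> /span2P[a [b ->]]; rewrite linearD !linearZ /= p21 p23 !scaler0 addr0.
(* With $[e_2,e_1] = a e_1 + b e_3$ and $[e_2,e_3] = a' e_1 + b' e_3$, Jacobi gives $[e_2,e_4] = (a
   + b') e_4$. *)
have p2e4 : p2 [l e2, e4] = 0.
  have [/span2P[a [b e21]] /span2P[a' [b' e23]]] := (e2q _ q1, e2q _ q3).
  rewrite bracket_jacobi e21 e23 bracketDl !bracketZl bracketxx scaler0 addr0.
  by rewrite !linearD !linearZ /= bracketxx linear0 p24 !scaler0 !addr0.
have p2u v : p2 [l u, v] = 0.
  rewrite bracketZl {1}(dec v) !linearD !linearZ /= p2e4 (p2span _ (e2q _ q1)).
  rewrite (p2span _ (e2q _ q2)) (p2span _ (e2q _ q3)).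
  by rewrite !(scaler0, addr0).
(* The value on [u] is $sg^2 = 1$, hence the constant $M = 1$. *)
exists (fun=> sg *: p2), (fun=> u), 1 => //; apply: pmp_exp => //.
- move=> _; apply/eqP => /(congr1 (fun h : 'Hom(g, R^o) => h u : R)).
  rewrite scale_lfunE zero_lfunE linearZ /= p22 => /eqP.
  by rewrite /GRing.scale /= mulr1 -expr2 sg_sq oner_eq0.
- by move=> v t; rewrite !scale_lfunE p2u scaler0; exact: is_derive_cst.
- by move=> _; rewrite scale_lfunE linearZ /= p22 /GRing.scale /= mulr1 -expr2.
- move=> _ w [/(basis3P _ bq)[a [b [d ->]]]].
  rewrite /F orthonormal_sp_norm => abd1.
  have : a ^+ 2 + b ^+ 2 + d ^+ 2 <= 1.
    by rewrite -(@ler_sqrt _ _ 1) ?ltr01 // sqrtr1.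
  rewrite scale_lfunE !linearD !linearZ /= p21 p22 p23 /GRing.scale /=.
  (* From $(sg - b)^2 \ge 0$ follows $2\,sg\,b \le 1 + b^2 \le 2$. *)
  have := sqr_ge0 a; have := sqr_ge0 d; have := sqr_ge0 (sg - b).
  have := sg_sq; nra.
Qed.

Lemma normal_exp_span : (exists psi, normal_wrt q F [set: R] gam psi) ->
  forall x, x \in q -> [l e2, x] \in <<[:: e1; e3]>>%VS.
Proof.
move=> [psi [u' [M M0 [[gac um uq gv] _ psic _ gpsi]]]].
have [q1 q2 q3] := e_in; have [bq _ _] := e_orthonormal.
have sg0 : sg != 0 by rewrite -sqrf_eq0 sg_sq oner_neq0.
have aeP : {ae (@lebesgue_measure R), forall t,
    (forall v, is_derive t (1 : R) (fun s => psi s v : R) (psi t [l u, v] : R)) /\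
    [/\ psi t e1 = 0, psi t e2 = sg * M & psi t e3 = 0]}.
  rewrite /ae_on in gv gpsi.
  have aeF := ae_filter_ringOfSetsType (@lebesgue_measure R).
  apply: (@filterS2 _ _ aeF _ _ _ _ gv gpsi) => t /(_ I)[gvt _] /(_ I)[dpsi [psiM psile]].
  have uE : u' t = u := has_velocity_unique gvt (exp_has_velocity expG_exp u t).
  rewrite uE in dpsi psiM; split=> //.
  apply: covector_max_eq => //; first by rewrite -psiM linearZ.
  move=> a b c abc1; have := psile (a *: e1 + b *: e2 + c *: e3).
  rewrite !linearD !linearZ; apply; split; first exact: e_q.
  by rewrite /F orthonormal_sp_norm -sqrtr1 ler_sqrt.
(* Continuity of [psi] turns almost-everywhere values into values at all times; only then can
   [psi t e1] and [psi t e3] be differentiated as zero functions. *)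
have psi0 v (k : R) :
    (forall t, [/\ psi t e1 = 0, psi t e2 = sg * M & psi t e3 = 0] -> psi t v = k) ->
    forall t, psi t v = k.
  move=> vk; apply: (@ae_eq_continuous _ (fun t => psi t v)).
    exact: abs_cont_continuous (psic v).
  have aeF := ae_filter_ringOfSetsType (@lebesgue_measure R).
  by apply: (@filterS _ _ aeF _ _ _ aeP) => t [_ /vk].
have psi1 := psi0 e1 0 (fun t => fun '(And3 h _ _) => h).
have psi3 := psi0 e3 0 (fun t => fun '(And3 _ _ h) => h).
(* One instant at which the adjoint equation holds is enough. *)
have [t _ [dpsi [_ pt2 _]]] := ae_itv aeP ltr01.
have key v : v \in q -> (forall s, psi s v = 0) -> [l e2, v] \in <<[:: e1; e3]>>%VS.
  move=> vq psiv; have /(basis3P _ bq)[a [b [d e2v]]] := e2_N vq.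
  suff b0 : b = 0 by apply/span2P; exists a, d; rewrite e2v b0 scale0r addr0.
  have [_] := dpsi v; rewrite (_ : (fun s => _) = cst 0); last exact/funext.
  (* The adjoint equation at [t] reads $0 = sg \cdot b \cdot (sg\,M)$, where neither [sg] nor [M] is
     zero. *)
  rewrite derive_cst bracketZl e2v linearZ !linearD !linearZ /= psi1 psi3 pt2.
  rewrite /GRing.scale /= !mulr0 add0r addr0 => /esym/eqP.
  by rewrite !mulf_eq0 (negbTE sg0) (gt_eqF M0) /= orbF => /eqP.
move=> _ /(basis3P _ bq)[a [b [d ->]]].
by rewrite !linearD !linearZ /= bracketxx scaler0 addr0 memvD // memvZ // key.
Qed.

End NormalizerExtremal.

(** * Normalization of the curve and conclusion *)

Theorem theorem3 (R : realType) (G : lieGroupType R 4) (g : lieAlgebraOf G)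
  (expG : g -> G) (q : {vspace g}) (e2 : g)
  (ip : g -> g -> R) (te1 te2 te3 : g) (d : G -> G -> R) (s : R)
  (G_connected : connected [set: G])
  (expG_exp : is_exp_map expG)
  (q_dim : \dim q = 3%N)
  (q_gen : generates q)
  (e2_q : e2 \in q) (e2_N : normalizer q e2) (e2_neq0 : e2 != 0)
  (ip_sp : scalar_product q ip)
  (te_orthonormal : orthonormal_basis q ip te1 te2 te3)
  (te_adapted : adapted_basis q te1 te2 te3)
  (te2_parallel : exists c : R, te2 = c *: e2)
  (d_metric : is_metric_of q (sp_norm ip) d)
  (s_sign : s = 1 \/ s = -1) :
  let F := sp_norm ip in
  let gam := fun t : R => expG ((s * t / F (s *: e2)) *: e2) in
  abnormal_extremal q F [set: R] gam /\
  (nonstrongly_abnormal q F [set: R] gam <->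
   (forall x, x \in q -> [l e2, x] \in <<[:: te1; te3]>>%VS)).
Proof.
move=> F gam.
have [c te2E] := te2_parallel.
have [bq _ _] := te_orthonormal.
have c0 : c != 0.
  (* If [te2] were zero, the coordinate triples (0, 1, 0) and (0, 0, 0) would give the same vector,
     with norms 1 and 0. *)
  apply/eqP => c0; have := orthonormal_sp_norm ip_sp te_orthonormal 0 1 0.
  have := orthonormal_sp_norm ip_sp te_orthonormal 0 0 0.
  rewrite te2E c0 !scale0r !scaler0 => -> /eqP.
  by rewrite expr1n expr0n !add0r addr0 sqrtr0 sqrtr1 eq_sym oner_eq0.
have e2E : e2 = c^-1 *: te2 by rewrite te2E scalerA mulVf // scale1r.
have s2 : s ^+ 2 = 1 by case: s_sign => ->; rewrite ?sqrrN expr1n.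
pose N := F (s *: e2).
have NE : N = Num.sqrt ((s / c) ^+ 2).
  have := orthonormal_sp_norm ip_sp te_orthonormal 0 (s / c) 0.
  rewrite !scale0r add0r addr0 expr0n add0r addr0 => <-.
  by rewrite /N {1}e2E scalerA.
have N2 : N ^+ 2 = (c ^+ 2)^-1.
  by rewrite NE sqr_sqrtr ?sqr_ge0 // expr_div_n s2 mul1r.
have N0 : N != 0 by rewrite -sqrf_eq0 N2 invr_eq0 sqrf_eq0.
(* Since $(s/N) e_2 = (s/(Nc))\, \tilde e_2$ and $N^2 = 1/c^2$, this factor is a sign. *)
pose sg := s / N / c.
have sg2 : sg ^+ 2 = 1.
  by rewrite /sg !expr_div_n s2 N2 mul1r invrK mulfV // sqrf_eq0.
have gamE : gam = fun t => expG (t *: (sg *: te2)).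
  apply/funext => t; rewrite /gam; congr expG; rewrite -/N.
  rewrite [in LHS]e2E !scalerA; congr (_ *: _); rewrite /sg; ring.
have te2_N : normalizer q te2 by move=> y yq; rewrite te2E bracketZl memvZ // e2_N.
have abn : abnormal_extremal q F [set: R] gam.
  by rewrite gamE; exact: (abnormal_exp ip_sp te_orthonormal).
(* The bracket condition is unchanged when [e2] is rescaled to [te2]. *)
have -> : (forall x, x \in q -> [l e2, x] \in <<[:: te1; te3]>>%VS) <->
    (forall x, x \in q -> [l te2, x] \in <<[:: te1; te3]>>%VS).
  split=> h x xq; first by rewrite te2E bracketZl memvZ // h.
  by rewrite e2E bracketZl memvZ // h.
split=> //; split=> [[_]|h].
  rewrite gamE; exact: (normal_exp_span ip_sp te_orthonormal).
split=> //; rewrite gamE; exact: (normal_exp ip_sp te_orthonormal).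
Qed.
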